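(* Let $(\mathcal S,\mathcal A,P,r)$ be a weakly communicating MDP and let $(g^\star,h^\star)$ be a solution of the modified Bellman equations. Let $f:\mathbb R^n\to\mathbb R$ be continuous with $f(x+c\mathbf 1)=f(x)+c$ for all $x\in\mathbb R^n$, $c\in\mathbb R$. Let $h^0\in\mathbb R^n$ and for $k\ge1$ \[h^k=\tfrac12 h^{k-1}+\tfrac12\big(Th^{k-1}-f(h^{k-1})\mathbf 1\big)\] (Relaxed Relative Value Iteration with $\lambda_k=1/2$), and let $\pi_k$ be a greedy policy, $T^{\pi_k}h^k=Th^k$. Then for $k\ge1$, \[\|g^\star-g^{\pi_k}\|_\infty\le\|Th^k-h^k-g^\star\|_\infty\le\frac{4}{\sqrt{\varpi k}}\|h^0-h^\star\|_\infty,\] where $\varpi=3.141592\ldots$ is the circle constant. Furthermore, $h^k\to h^\infty$ and $f(h^k)\mathbf 1\to g^\star$ for some solution $(g^\star,h^\infty)$ of the modified Bellman equations.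
   Context: An MDP $(\mathcal S,\mathcal A,P,r)$ has finite state space $\mathcal S$ ($|\mathcal S|=n$, functions identified with $\mathbb R^n$), finite action space, transition probabilities $P(s'\mid s,a)$ and bounded reward $r$. For a policy $\pi$: $r^\pi(s)=\sum_a\pi(a\mid s)r(s,a)$, $\mathcal P^\pi(s,s')=\sum_a\pi(a\mid s)P(s'\mid s,a)$, $g^\pi(s)=\liminf_{T\to\infty}\frac1T\mathbb E_\pi[\sum_{t=0}^{T-1}r(s_t,a_t)\mid s_0=s]$, $g^\star=\max_\pi g^\pi$ (pointwise). $T^\pi V=r^\pi+\mathcal P^\pi V$, $(TV)(s)=\max_a\{r(s,a)+\sum_{s'}P(s'\mid s,a)V(s')\}$. $\mathbf 1$ is the all-ones vector. A pair $(g,h)$ solves the modified Bellman equations if $\max_a\sum_{s'}P(s'\mid s,a)g(s')=g(s)$ and $\max_a\{r(s,a)+\sum_{s'}P(s'\mid s,a)h(s')\}=h(s)+g(s)$ for all $s$, with some policy attaining both maxima simultaneously; the first component of any solution equals $g^\star$. An MDP is weakly communicating if there is a closed set of states such that each state in it is accessible from every other state in it under some deterministic policy, plus a possibly empty set of states that is transient under every policy. *)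

(* Defs.v *)
From HB Require Import structures.
From mathcomp Require Import all_boot all_order all_algebra.
From mathcomp Require Import all_classical all_reals all_analysis.
Set Implicit Arguments. Unset Strict Implicit. Unset Printing Implicit Defensive.
Import Order.TTheory GRing.Theory Num.Theory.
Import numFieldNormedType.Exports.
Local Open Scope classical_set_scope.
Local Open Scope ring_scope.

Section MDP.
Variables (R : realType) (n : nat) (A : finType).
Variables (P : 'I_n -> A -> 'I_n -> R) (r : 'I_n -> A -> R).

Definition is_kernel : Prop :=
  (forall s a s', 0 <= P s a s') /\ (forall s a, \sum_s' P s a s' = 1).

Definition is_policy (pi : 'I_n -> A -> R) : Prop :=
  (forall s a, 0 <= pi s a) /\ (forall s, \sum_a pi s a = 1).

Definition rpol (pi : 'I_n -> A -> R) : 'cV[R]_n :=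
  \col_s \sum_a pi s a * r s a.
Definition Ppol (pi : 'I_n -> A -> R) : 'M[R]_n :=
  \matrix_(s, s') \sum_a pi s a * P s a s'.

Definition Tpol (pi : 'I_n -> A -> R) (V : 'cV[R]_n) : 'cV[R]_n :=
  rpol pi + Ppol pi *m V.

(* Bellman operator: (T V)(s) = max_a { r(s,a) + sum_s' P(s'|s,a) V(s') };
   a0 : A is any action (the max over the nonempty finite set A) *)
Definition Qval (V : 'cV[R]_n) s a : R := r s a + \sum_s' P s a s' * V s' 0.
Definition Tbell (a0 : A) (V : 'cV[R]_n) : 'cV[R]_n :=
  \col_s \big[Num.max/Qval V s a0]_a Qval V s a.
Definition Pmax (a0 : A) (g : 'cV[R]_n) : 'cV[R]_n :=
  \col_s \big[Num.max/(\sum_s' P s a0 s' * g s' 0)]_a \sum_s' P s a s' * g s' 0.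

Definition det_policy (d : 'I_n -> A) : 'I_n -> A -> R :=
  fun s a => if a == d s then 1 else 0.

(* average reward g^pi(s) = liminf_T (1/T) E_pi[sum_{t<T} r(s_t,a_t) | s_0 = s];
   for a stationary Markov policy E_pi[r(s_t,a_t)|s_0=s] = ((P^pi)^t r^pi)(s) *)
Definition gain (pi : 'I_n -> A -> R) : 'cV[R]_n :=
  \col_s limn_inf (fun T : nat =>
      (T%:R)^-1 * \sum_(t < T) ((Ppol pi ^+ t) *m rpol pi) s 0).

Definition mod_bellman (a0 : A) (g h : 'cV[R]_n) : Prop :=
  Pmax a0 g = g /\ Tbell a0 h = h + g /\
  exists pi, is_policy pi /\ Ppol pi *m g = g /\ Tpol pi h = h + g.

Definition accessible (d : 'I_n -> A) (s s' : 'I_n) : Prop :=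
  exists t : nat, 0 < (Ppol (det_policy d) ^+ t) s s'.

(* s is transient for the Markov chain of pi: finite expected number of visits *)
Definition transient (pi : 'I_n -> A -> R) (s : 'I_n) : Prop :=
  cvg (series (fun t : nat => (Ppol pi ^+ t) s s) @ \oo).

Definition closed_set (C : {set 'I_n}) : Prop :=
  forall s a s', s \in C -> 0 < P s a s' -> s' \in C.

Definition weakly_communicating : Prop :=
  exists C : {set 'I_n},
    closed_set C /\
    (forall s s', s \in C -> s' \in C -> exists d, accessible d s s') /\
    (forall s, s \notin C -> forall pi, is_policy pi -> transient pi s).

End MDP.

Definition supn {R : realType} {n : nat} (v : 'cV[R]_n) : R :=
  \big[Num.max/0]_i `|v i ord0|.
Definition ones {R : realType} {n : nat} : 'cV[R]_n := const_mx 1.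

(* Main.v *)
Require Import Defs.
From HB Require Import structures.
From mathcomp Require Import all_boot all_order all_algebra.
From mathcomp Require Import all_classical all_reals all_analysis.
From mathcomp Require Import ring lra zify.
Import Order.TTheory GRing.Theory Num.Theory.
Import numFieldNormedType.Exports.
Local Open Scope classical_set_scope.
Local Open Scope ring_scope.

(** Subtracting the constant gain [c] from the Bellman operator gives a sup-norm
    nonexpansive map [T] with fixed point [hs], and the iterates [h k] differ
    from the averaged iterates [y (k+1) = (y k + T (y k)) / 2] by multiples of
    [ones] only.  For these, the Baillon-Bruck argument bounds the distances
    [|y m - y n|] and [|y m - T (y n)|] by binomial probabilities that satisfy the
    same two-term recursions; at [m = n] this is a central binomial coefficient,
    estimated by the Wallis inequality.  Compactness and Fejer monotonicity give
    the convergence of [y], and then the shift [h k - y k] follows an averaging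
    recursion towards [c - f (lim y)].  The gain is constant because the states
    where it is minimal are closed under every action, those where it is maximal
    are closed under the optimal policy, and a nonempty closed set cannot consist
    of transient states only. *)

(** * Central binomial coefficients *)

Section Wallis.
Context {R : realType}.
Implicit Types x : R.

(* Primitives of [sin ^+ n] obtained by integration by parts; their values at
   [pi / 2] are the Wallis integrals. *)
Fixpoint sin_primitive (n : nat) (x : R) : R :=
  match n with
  | 0 => x
  | 1 => 1 - cos x
  | (m.+1 as m').+1 =>
      (m'%:R * sin_primitive m x - cos x * sin x ^+ m') / m'.+1%:R
  end.

(** The recursion steps by two, so two consecutive indices are proved together;
    [cos ^+ 2 = 1 - sin ^+ 2] turns the derivative of the product into the next power. *)
Lemma is_derive_sin_primitive (n : nat) x :
  is_derive x 1 (sin_primitive n) (sin x ^+ n).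
Proof.
suff: is_derive x 1 (sin_primitive n) (sin x ^+ n) /\
      is_derive x 1 (sin_primitive n.+1) (sin x ^+ n.+1) by case.
elim: n => [|n [IH IHS]]; split => //.
- exact: is_derive_id.
- have -> : sin_primitive 1 = cst 1 - cos by apply/funext.
  by apply: is_derive_eq; rewrite expr1 sub0r opprK.
- have -> : sin_primitive n.+2 =
      (n.+2%:R)^-1 \*: (n.+1%:R \*: sin_primitive n - cos * (sin ^+ n.+1)).
    apply/funext => y; rewrite /GRing.scale /= mulrC; congr (_ * (_ - _)).
    by rewrite !fctE.
  have dM := is_deriveM (is_derive_cos x) (is_deriveX n.+1 (is_derive_sin x)).
  have d := is_deriveZ (n.+2%:R^-1) (is_deriveB (is_deriveZ n.+1%:R IH) dM).
  apply: DeriveDef; first by case: d.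
  rewrite (@derive_val _ _ _ _ _ _ _ d).
  have -> : (sin ^+ n.+1) x = sin x ^+ n.+1 by rewrite fctE.
  have c2 : cos x * cos x = 1 - sin x * sin x.
    by rewrite -!expr2 -(cos2Dsin2 x) addrK.
  rewrite /GRing.scale /= mulrCA c2 !exprS; field.
  by rewrite -[2]/(2%:R) -natrD pnatr_eq0.
Qed.

Lemma sin_primitive_0 (n : nat) : sin_primitive n 0 = 0.
Proof.
suff: sin_primitive n 0 = 0 /\ sin_primitive n.+1 0 = 0 by case.
elim: n => [|n [IH IHS]]; split => //.
  by rewrite /= cos0 subrr.
by rewrite [LHS]/= IH sin0 expr0n /= !mulr0 subrr mul0r.
Qed.

(** The difference of the two primitives vanishes at 0 and has derivative
    [(1 - sin x) * sin x ^+ n], nonnegative between 0 and [pi / 2]. *)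
Lemma sin_primitive_pihalf_le (n : nat) :
  sin_primitive n.+1 (pi / 2) <= sin_primitive n (pi / 2).
Proof.
have dF x : is_derive x 1 (sin_primitive n - sin_primitive n.+1)
    (sin x ^+ n - sin x ^+ n.+1).
  have := is_derive_sin_primitive n x; have := is_derive_sin_primitive n.+1 x.
  by move=> ? ?; apply: is_deriveB.
have pi_ge0' : 0 <= pi / 2 :> R by rewrite divr_ge0 // pi_ge0.
have := @ger0_derive1_ndecr R (sin_primitive n - sin_primitive n.+1) 0 (pi / 2).
move=> /(_ _ _ _ 0 (pi / 2) (lexx _) pi_ge0' (lexx _)).
rewrite !fctE !sin_primitive_0 subrr subr_ge0; apply.
- by move=> x _; case: (dF x).
- move=> x; rewrite in_itv /= => /andP[x0 xpi].
  rewrite derive1E derive_val exprS -{1}[sin x ^+ n]mul1r -mulrBl.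
  by rewrite mulr_ge0 ?subr_ge0 ?sin_le1 // exprn_ge0 // ltW // sin_gt0_pihalf // x0.
- by apply: derivable_within_continuous => x _; case: (dF x).
Qed.

Lemma sin_primitive_pihalfSS (n : nat) : sin_primitive n.+2 (pi / 2) =
  n.+1%:R / n.+2%:R * sin_primitive n (pi / 2).
Proof. by rewrite [LHS]/= cos_pihalf mul0r subr0 mulrAC. Qed.

(** Up to a factor 4 this is the Wallis ratio of [sin_primitive_pihalfSS], so central binomial
    coefficients express the Wallis integrals of both parities. *)
Lemma central_binomialS (n : nat) :
  (n.+1 * 'C(n.+1.*2, n.+1) = 2 * n.*2.+1 * 'C(n.*2, n))%N.
Proof.
have := mul_bin_diag n.+1.*2 n; have := mul_bin_down n.*2.+1 n.
rewrite doubleS /= => h1 h2; rewrite -h2 -mulnA h1; nia.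
Qed.

Lemma sin_primitive_pihalf_even (n : nat) : sin_primitive n.*2 (pi / 2) =
  pi / 2 * ('C(n.*2, n)%:R / 4 ^+ n).
Proof.
elim: n => [|n IH]; first by rewrite bin0 expr0 divr1 mulr1.
rewrite doubleS sin_primitive_pihalfSS IH exprS.
have : n.+1%:R * 'C(n.+1.*2, n.+1)%:R = 2 * n.*2.+1%:R * 'C(n.*2, n)%:R :> R.
  by rewrite -!natrM central_binomialS.
rewrite -doubleS -mul2n natrM; move: (pi) (n.*2.+1%:R) ('C(n.*2, n)%:R) ('C(_, _)%:R) => p a b c h.
have n0 : n.+1%:R != 0 :> R by rewrite pnatr_eq0.
have -> : c = 2 * a * b / n.+1%:R by rewrite -h mulrC mulKf.
by field; rewrite expf_neq0 // nat1r.
Qed.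

Lemma sin_primitive_pihalf_odd (n : nat) :
  sin_primitive n.*2.+1 (pi / 2) * (n.+1.*2%:R * 'C(n.+1.*2, n.+1)%:R) = 4 ^+ n.+1.
Proof.
elim: n => [|n IH]; first by rewrite /= cos_pihalf subr0 mul1r -natrM expr1.
rewrite doubleS sin_primitive_pihalfSS exprS -IH.
have : n.+2%:R * 'C(n.+2.*2, n.+2)%:R = 2 * n.+1.*2.+1%:R * 'C(n.+1.*2, n.+1)%:R :> R.
  by rewrite -!natrM central_binomialS.
rewrite -[n.*2.+2]doubleS -[n.+2.*2]mul2n natrM.
move: (sin_primitive _ _) (n.+1.*2%:R) ('C(n.+1.*2, n.+1)%:R) ('C(_, _)%:R) => p a b c h.
have a0 : n.+1.*2.+1%:R != 0 :> R by rewrite pnatr_eq0.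
by rewrite -(mulrA 2) h; field.
Qed.

(** With [c / q] for the left side, the Wallis inequality between the indices 2n+2 and 2n+1 reads
    [pi / 2 * (c / q) <= q / (n.+1.*2 * c)], that is [pi * n.+1 * (c / q) ^+ 2 <= 1]. *)
Lemma central_binomial_le (n : nat) :
  'C(n.+1.*2, n.+1)%:R / 4 ^+ n.+1 <= (Num.sqrt (pi * n.+1%:R))^-1 :> R.
Proof.
have := sin_primitive_pihalf_le n.*2.+1.
rewrite -doubleS sin_primitive_pihalf_even.
have := sin_primitive_pihalf_odd n.
set c : R := 'C(_, _)%:R; set q : R := 4 ^+ _ => odd le.
have q0 : 0 < q by rewrite exprn_gt0.
have c0 : 0 < c by rewrite ltr0n bin_gt0; lia.
have N0 : 0 < n.+1%:R :> R by rewrite ltr0n.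
have pN0 : 0 < pi * n.+1%:R :> R by rewrite mulr_gt0 // pi_gt0.
have s0 : 0 < Num.sqrt (pi * n.+1%:R) :> R by rewrite sqrtr_gt0.
rewrite -[leRHS]mul1r ler_pdivlMr // -(@ler_pXn2r _ 2) ?nnegrE ?ler01 //; last first.
  by rewrite mulr_ge0 ?divr_ge0 // ltW.
rewrite exprMn sqr_sqrtr ?(ltW pN0) // expr1n.
have k0 : 0 < n.+1.*2%:R * c / q by rewrite divr_gt0 // mulr_gt0 // ltr0n.
have := le; rewrite -(ler_pM2r k0) => /le_trans -/(_ 1).
have -> : sin_primitive n.*2.+1 (pi / 2) * (n.+1.*2%:R * c / q) = 1.
  by rewrite mulrA odd mulfV // gt_eqF.
rewrite -mul2n natrM => /(_ (lexx _)); apply: le_trans.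
by rewrite le_eqVlt; apply/orP; left; apply/eqP; field; rewrite gt_eqF.
Qed.

End Wallis.

(** * Krasnoselskii-Mann iteration *)

(* For [B] binomial of parameters [n + m] and 1/2, [strict_window m n / 2 ^ (n + m)]
   is the probability of [m < B <= n], and [wide_window m n / 2 ^ (n + m)] that of
   [m <= B <= n + 1]. *)
Definition strict_window (m n : nat) : nat := \sum_(m.+1 <= i < n.+1) 'C(n + m, i).
Definition wide_window (m n : nat) : nat := \sum_(m <= i < n.+2) 'C(n + m, i).

(** Pascal's rule splits the sum in two; moving the top term ['C(n + m, n.+1)] from one half to the
    other leaves the two windows. *)
Lemma strict_windowS (m n : nat) : (m <= n)%N ->
  strict_window m n.+1 = (strict_window m n + wide_window m n)%N.
Proof.
move=> mn; rewrite /strict_window /wide_window addSn big_add1 /=.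
under eq_bigr do rewrite binS.
rewrite big_split /= [X in (X + _)%N = _]big_nat_recr //= -addnA; congr (_ + _)%N.
  by rewrite [in RHS]big_add1.
by rewrite addnC [RHS]big_nat_recr //; lia.
Qed.

Lemma wide_windowS (m n : nat) : wide_window m.+1 n = strict_window m n.+1.
Proof. by rewrite /wide_window /strict_window addnS addSn. Qed.

Lemma wide_window0 (n : nat) : wide_window 0 n = (2 ^ n)%N.
Proof.
rewrite /wide_window addn0 big_nat_recr //= bin_small // addn0.
rewrite -[2%N]/(1 + 1)%N expnDn big_mkord.
by apply: eq_bigr => i _; rewrite !exp1n !muln1.
Qed.

(** The window is ['C(n.*2.+1, n.+1)], one of the two equal middle entries of its row, which add up
    to the next central coefficient. *)
Lemma wide_window_diag (n : nat) : (2 * wide_window n n)%N = 'C(n.+1.*2, n.+1).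
Proof.
rewrite /wide_window big_nat_recr //= big_nat1 addnn doubleS.
have E : 'C(n.*2.+1, n) = 'C(n.*2.+1, n.+1).
  by rewrite -bin_sub; [congr ('C(_, _)); lia | lia].
rewrite [in RHS]binS E (binS n.*2 n); lia.
Qed.

Lemma scaler_half_double {R : numFieldType} {V : lmodType R} (v : V) :
  2^-1 *: (v + v) = v.
Proof. by rewrite scalerDr -scalerDl -[2^-1]mul1r -splitr scale1r. Qed.

Section KrasnoselskiiMann.
Context {R : realType} {V : normedModType R}.
Variables (T : V -> V) (x : nat -> V).
Hypothesis T_nonexp : forall v w, `|T v - T w| <= `|v - w|.
Hypothesis xS : forall k, x k.+1 = 2^-1 *: (x k + T (x k)).

(* [x n.+1] is the midpoint of [x n] and [T (x n)], so [|x m - x n.+1|] is at most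
   the mean of [|x m - x n|] and [|x m - T (x n)|]; likewise [|x m.+1 - T (x n)|] is
   at most the mean of [|x m - T (x n)|] and [|x m - x n|]. *)
Lemma km_window_bound (D : R) : (forall n, `|x 0%N - T (x n)| <= D) ->
  forall m n, (m <= n)%N ->
  `|x m - x n| <= D * (strict_window m n)%:R / 2 ^+ (n + m) /\
  `|x m - T (x n)| <= D * (wide_window m n)%:R / 2 ^+ (n + m).
Proof.
(* Induction on [n + m]: apart from the direct cases [m = n] and [m = 0], each bound at total [N.+1]
   follows from both bounds at total [N]. *)
move=> xD m n; move: {2}(n + m)%N (erefl (n + m)%N) => N.
elim: N m n => [|N IH] m n mnN mn.
  have [-> ->] : m = 0%N /\ n = 0%N by lia.
  split; first by rewrite subrr normr0 /strict_window big_geq // mulr0 mul0r.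
  by rewrite wide_window0 expr0 mulr1 divr1.
have avg (a b c : V) (da db : R) : `|a - c| <= da -> `|b - c| <= db ->
    `|2^-1 *: (a + b) - c| <= (da + db) / 2.
  move=> ac bc.
  have -> : 2^-1 *: (a + b) - c = 2^-1 *: ((a - c) + (b - c)).
    by rewrite addrACA -opprD scalerBr scaler_half_double.
  rewrite normrZ ger0_norm ?invr_ge0 // mulrC ler_pM2r ?invr_gt0 //.
  by apply: le_trans (ler_normD _ _) _; apply: lerD.
have half (a b : R) : (D * a / 2 ^+ N + D * b / 2 ^+ N) / 2 = D * (a + b) / 2 ^+ N.+1.
  by rewrite exprS; field; rewrite expf_neq0.
split.
- have [emn|m_neq_n] := eqVneq m n.
    by rewrite emn subrr normr0 /strict_window big_geq // mulr0 mul0r.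
  case: n mn mnN m_neq_n => [|n] mn mnN mNn; first by lia.
  have mn' : (m <= n)%N by lia.
  have mnN' : (n + m)%N = N by lia.
  have [] := IH m n mnN' mn'; rewrite mnN' mnN strict_windowS // natrD -half.
  by move=> h1 h2; rewrite distrC xS; apply: avg; rewrite distrC.
- case: m mn mnN => [|m] mn mnN.
    by rewrite wide_window0 addn0 natrX mulfK ?expf_neq0 ?xD.
  have mn' : (m <= n)%N by lia.
  have mnN' : (n + m)%N = N by lia.
  have [] := IH m n mnN' mn'.
  rewrite mnN' mnN wide_windowS strict_windowS // natrD -half [D * _ / _ + _]addrC.
  move=> h1 h2; rewrite xS; apply: avg => //.
  exact: le_trans (T_nonexp _ _) h1.
Qed.

(** [x k.+1 - xs] is the midpoint of [x k - xs] and [T (x k) - T xs]. *)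
Lemma km_fejer (xs : V) (k : nat) : T xs = xs -> `|x k.+1 - xs| <= `|x k - xs|.
Proof.
move=> Txs; rewrite xS.
have -> : 2^-1 *: (x k + T (x k)) - xs = 2^-1 *: (x k - xs) + 2^-1 *: (T (x k) - T xs).
  by rewrite Txs -scalerDr addrACA -opprD scalerBr scaler_half_double.
apply: le_trans (ler_normD _ _) _; rewrite !normrZ ger0_norm ?invr_ge0 //.
have := T_nonexp (x k) xs; lra.
Qed.

(** This is the window bound at [m = n = k], with [D] twice the initial distance to [xs]: both [x 0]
    and each [T (x n)] lie within that distance of [xs]. *)
Lemma km_residual (xs : V) (k : nat) : T xs = xs ->
  `|T (x k) - x k| <= 4 / Num.sqrt (pi * k.+1%:R) * `|x 0%N - xs|.
Proof.
move=> Txs.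
have fejer n : `|x n - xs| <= `|x 0%N - xs|.
  by elim: n => // n IH; apply: le_trans (km_fejer _ n Txs) IH.
have D2 n : `|x 0%N - T (x n)| <= 2 * `|x 0%N - xs|.
  have -> : x 0%N - T (x n) = (x 0%N - xs) - (T (x n) - T xs) by rewrite Txs opprB addrA subrK.
  apply: le_trans (ler_normB _ _) _.
  have := T_nonexp (x n) xs; have := fejer n; lra.
have [_] := km_window_bound _ D2 k k (leqnn k).
rewrite distrC => /le_trans; apply.
have -> : 2 * `|x 0%N - xs| * (wide_window k k)%:R / 2 ^+ (k + k) =
    4 * `|x 0%N - xs| * ('C(k.+1.*2, k.+1)%:R / 4 ^+ k.+1).
  have -> : 2 ^+ (k + k) = 4 ^+ k :> R by rewrite addnn -mul2n exprM -natrX.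
  by rewrite -wide_window_diag natrM exprS; field; rewrite expf_neq0.
rewrite mulrAC ler_wpM2r // ler_wpM2l //; exact: central_binomial_le.
Qed.

End KrasnoselskiiMann.

(** A cluster point is fixed because the residuals vanish, and Fejer monotonicity with respect to it
    turns clustering into convergence. *)
Lemma km_cvg_compact {R : realType} {V : normedModType R} (T : V -> V)
    (x : nat -> V) (K : set V) :
  (forall v w, `|T v - T w| <= `|v - w|) ->
  (forall k, x k.+1 = 2^-1 *: (x k + T (x k))) ->
  compact K -> (forall k, K (x k)) ->
  (fun k => `|T (x k) - x k|) @ \oo --> 0 ->
  exists2 y, T y = y & x @ \oo --> y.
Proof.
move=> T_nonexp xS cK Kx res.
have [|y [_ clus]] := cK (x @ \oo) _ _.
  by exists 0%N => // k _; exact: Kx.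
have near_y e N : 0 < e -> exists2 p, (N <= p)%N & `|y - x p| < e.
  move=> e0; have [] := clus [set x p | p in [set p | (N <= p)%N]] (ball y e).
  - by exists N => // p Np; exists p.
  - exact: nbhsx_ballx.
  by move=> _ [[p Np <-] yp]; exists p => //; move: yp; rewrite -ball_normE.
have Ty : T y = y.
  apply/eqP; rewrite -subr_eq0 -normr_le0; apply/ler_addgt0Pr => e e0; rewrite add0r.
  have e3 : 0 < e / 3 by rewrite divr_gt0.
  have [N _ resN] : \forall k \near \oo, `|0 - `|T (x k) - x k| | < e / 3.
    by move/cvgrPdist_lt: res; exact.
  have [p Np yp] := near_y _ N e3.
  have := resN p Np; rewrite /= sub0r normrN normr_id => resp.
  have -> : T y - y = (T y - T (x p)) + ((T (x p) - x p) + (x p - y)).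
    by rewrite !subrKA.
  apply: le_trans (ler_normD _ _) _.
  have := ler_normD (T (x p) - x p) (x p - y).
  have := T_nonexp y (x p); rewrite (distrC (x p) y); lra.
exists y => //; apply/cvgrPdist_lt => e e0.
have [p _ yp] := near_y e 0%N e0.
exists p => // q /= pq; apply: le_lt_trans yp.
rewrite distrC [leRHS]distrC -(subnK pq); elim: (q - p)%N => // m IH.
rewrite addSn; apply: le_trans IH; exact: km_fejer.
Qed.

(** * Norm and topology of column vectors *)

Lemma mx_norm_ge_coord {R : realType} {n : nat} (v : 'cV[R]_n) i : `|v i 0| <= `|v|.
Proof.
rewrite [leRHS]/Num.norm /= mx_normrE.
exact: (le_bigmax_cond _ (fun ij => `|v ij.1 ij.2|) (erefl : xpredT (i, 0))).
Qed.

Lemma mx_norm_le_coord {R : realType} {n : nat} (v : 'cV[R]_n) (c : R) :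
  0 <= c -> (forall i, `|v i 0| <= c) -> `|v| <= c.
Proof.
move=> c0 vc; rewrite [leLHS]/Num.norm /= mx_normrE.
by apply/bigmax_leP; split => // -[i j] _ /=; rewrite ord1.
Qed.

Lemma supnE {R : realType} {n : nat} (v : 'cV[R]_n) : supn v = `|v|.
Proof.
apply/eqP; rewrite eq_le; apply/andP; split.
  by apply/bigmax_leP; split => // i _; exact: mx_norm_ge_coord.
apply: mx_norm_le_coord => [|i]; first exact: bigmax_ge_id.
exact: (le_bigmax_cond _ (fun i => `|v i 0|) (erefl : xpredT i)).
Qed.

Lemma mx_norm_trmx {R : realType} (m n : nat) (A : 'M[R]_(m, n)) : `|A^T| = `|A|.
Proof.
have le (p q : nat) (B : 'M[R]_(p, q)) : `|B^T| <= `|B|.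
  rewrite [leLHS]/Num.norm [leRHS]/Num.norm /= !mx_normrE.
  apply/bigmax_leP; split => [|[i j] _ /=]; first exact: bigmax_ge_id.
  rewrite mxE.
  exact: (le_bigmax_cond _ (fun ij => `|B ij.1 ij.2|) (erefl : xpredT (j, i))).
by apply/eqP; rewrite eq_le le /= -[in leLHS](trmxK A) le.
Qed.

Lemma trmx_continuous {T : topologicalType} (m n : nat) :
  continuous (@trmx T m n).
Proof.
move=> A B [U AU UB]; exists (fun i j => U j i).
  by move=> i j; have := AU j i; rewrite mxE.
by move=> C CU; apply: UB => i j; rewrite mxE; exact: CU.
Qed.

(** Heine-Borel for row vectors, carried over by the transpose, a continuous isometry. *)
Lemma cV_ball_compact {R : realType} (n : nat) (M : R) :
  compact [set v : 'cV[R]_n | `|v| <= M].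
Proof.
have -> : [set v : 'cV[R]_n | `|v| <= M] = trmx @` [set v : 'rV[R]_n | `|v| <= M].
  apply/seteqP; split => [v vM|_ [v vM <-]] /=; last by rewrite mx_norm_trmx.
  by exists v^T; rewrite ?trmxK //= mx_norm_trmx.
apply: continuous_compact.
  exact/continuous_subspaceT/trmx_continuous.
apply: bounded_closed_compact.
  exists M; split; first exact: num_real.
  by move=> N MN v /= vM; apply: le_trans vM _; exact: ltW.
have -> : [set v : 'rV[R]_n | `|v| <= M] = Num.norm @^-1` [set x : R | x <= M] by [].
by apply: closed_comp; [move=> v _; exact: norm_continuous|exact: closed_le].
Qed.

(** * Stochastic matrices *)

Definition stochastic {R : realType} {n : nat} (Q : 'M[R]_n) : Prop :=
  (forall i j, 0 <= Q i j) /\ (forall i, \sum_j Q i j = 1).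

Section Stochastic.
Context {R : realType} {n : nat}.
Implicit Types (Q : 'M[R]_n) (v : 'cV[R]_n) (D : {set 'I_n}).

Lemma average_norm_le (w : 'I_n -> R) v : (forall j, 0 <= w j) -> \sum_j w j = 1 ->
  `|\sum_j w j * v j 0| <= `|v|.
Proof.
move=> w0 w1; apply: le_trans (ler_norm_sum _ _ _) _.
rewrite -[leRHS]mul1r -w1 mulr_suml; apply: ler_sum => j _.
by rewrite normrM ger0_norm // ler_wpM2l // mx_norm_ge_coord.
Qed.

(** The terms [w j * (g j - m)] are nonnegative with sum at most 0, hence all zero. *)
Lemma average_min_eq (w : 'I_n -> R) (g : 'I_n -> R) (m : R) :
  (forall j, 0 <= w j) -> \sum_j w j = 1 -> (forall j, m <= g j) ->
  \sum_j w j * g j <= m -> forall j, 0 < w j -> g j = m.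
Proof.
move=> w0 w1 gm le j wj.
have term_ge0 i : 0 <= w i * (g i - m) by rewrite mulr_ge0 // subr_ge0.
have : \sum_i w i * (g i - m) = 0.
  apply/eqP; rewrite eq_le sumr_ge0 // andbT.
  under eq_bigr do rewrite mulrBr.
  by rewrite sumrB -mulr_suml w1 mul1r subr_le0.
move/psumr_eq0P => /(_ (fun i _ => term_ge0 i) j isT) /eqP.
by rewrite mulf_eq0 gt_eqF //= subr_eq0 => /eqP.
Qed.

Lemma stochastic_norm_le Q v : stochastic Q -> `|Q *m v| <= `|v|.
Proof.
move=> [Q0 Q1]; apply: mx_norm_le_coord => // i.
by rewrite mxE; exact: average_norm_le.
Qed.

Lemma stochastic_ones Q (c : R) : stochastic Q ->
  Q *m (c *: ones) = c *: ones.
Proof.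
move=> [_ Q1]; rewrite -scalemxAr; congr (_ *: _); apply/matrixP => i j.
rewrite !mxE -[RHS](Q1 i); apply: eq_bigr => k _; by rewrite mxE mulr1.
Qed.

Lemma stochastic_exp Q t : stochastic Q -> stochastic (Q ^+ t).
Proof.
move=> [Q0 Q1]; elim: t => [|t [IH0 IH1]].
  rewrite expr0; split=> [i j|i]; first by rewrite mxE; case: eqP.
  rewrite (bigD1 i) //= big1 ?addr0 ?mxE ?eqxx // => j ji.
  by rewrite mxE eq_sym (negbTE ji).
rewrite exprS; split=> [i j|i].
  by rewrite mxE; apply: sumr_ge0 => k _; rewrite mulr_ge0.
under eq_bigr do rewrite mxE.
rewrite exchange_big /=; under eq_bigr do rewrite -mulr_sumr IH1 mulr1.
exact: Q1.
Qed.

(** Only the paths that are at [j] at time [s] are kept. *)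
Lemma stochastic_expD_ge Q s t i j k : stochastic Q ->
  (Q ^+ s) i j * (Q ^+ t) j k <= (Q ^+ (s + t)) i k.
Proof.
move=> Qs; rewrite exprD mxE (bigD1 j) //= lerDl; apply: sumr_ge0 => l _.
by apply: mulr_ge0; [case: (stochastic_exp _ s Qs)|case: (stochastic_exp _ t Qs)].
Qed.

Lemma closed_exp Q D t i j : stochastic Q ->
  (forall i j, i \in D -> 0 < Q i j -> j \in D) ->
  i \in D -> 0 < (Q ^+ t) i j -> j \in D.
Proof.
move=> [Q0 Q1] Dcl; elim: t i => [|t IH] i iD.
  by rewrite expr0 mxE; case: eqP => [<-//|_]; rewrite ltxx.
rewrite exprS mxE => /lt0r_neq0 /eqP sum_neq0.
have [k Qk] : exists k, Q i k * (Q ^+ t) k j != 0.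
  apply/not_existsP => all0; apply: sum_neq0; apply: big1 => k _.
  by apply/eqP/negPn/negP; exact: all0.
move: Qk; rewrite mulf_eq0 negb_or => /andP[Qik Qkj].
apply: (IH k); first by apply: (Dcl i) => //; rewrite lt0r Qik Q0.
by rewrite lt0r Qkj (stochastic_exp _ t (conj Q0 Q1)).1.
Qed.

(* In a minimal set of states closed under accessibility, every [j] leads back
   to [i0], so the summability of the returns to [j] bounds the expected number
   of visits to [j] from [i0]; summing over [j] bounds the total time spent. *)
Lemma closed_set_not_transient Q D : stochastic Q ->
  (forall i j, i \in D -> 0 < Q i j -> j \in D) -> (exists i, i \in D) ->
  ~ (forall i, i \in D -> cvg (series (fun t => (Q ^+ t) i i) @ \oo)).
Proof.
move=> Qs Dcl [d dD] Dtrans.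
have Q0 t i j : 0 <= (Q ^+ t) i j by case: (stochastic_exp _ t Qs).
pose reach i := [set j | `[< exists t, 0 < (Q ^+ t) i j >]]%SET.
have reachP i j : reflect (exists t, 0 < (Q ^+ t) i j) (j \in reach i).
  by rewrite inE; exact: asboolP.
have reach_refl i : i \in reach i.
  by apply/reachP; exists 0%N; rewrite expr0 mxE eqxx ltr01.
have reach_trans i j k : j \in reach i -> k \in reach j -> k \in reach i.
  move=> /reachP[s Qs'] /reachP[t Qt]; apply/reachP; exists (s + t)%N.
  by apply: lt_le_trans (stochastic_expD_ge _ s t i j k Qs); rewrite mulr_gt0.
(* The set reachable from [i0] is as small as possible, so each [j] in it reaches the whole set,
   [i0] included. *)
case: (arg_minnP (fun i => #|reach i|) dD) => i0 i0D i0min.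
have back j : j \in reach i0 -> i0 \in reach j.
  move=> ji0.
  have jD : j \in D by have /reachP[t Qt] := ji0; exact: closed_exp Qt.
  have sub : reach j \subset reach i0.
    by apply/fintype.subsetP => k; exact: reach_trans.
  have /eqP -> // : reach j == reach i0.
  by rewrite eqEcard sub i0min.
have visits j : exists M, forall T, \sum_(t < T) (Q ^+ t) i0 j <= M.
  have [ji0|ji0] := boolP (j \in reach i0); last first.
    exists 0 => T; rewrite big1 // => t _; apply/eqP; rewrite eq_le Q0 andbT leNgt.
    by apply: contra ji0 => Qt; apply/reachP; exists t.
  have jD : j \in D by have /reachP[t Qt] := ji0; exact: closed_exp Qt.
  have /reachP[s p0] := back j ji0.
  (* Going from [j] to [i0] in [s] steps and on to [j] in [t] steps is a return to [j], so the
     visits from [i0], weighted by [(Q ^+ s) j i0], are dominated by the returns. *)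
  exists (limn (series (fun t => (Q ^+ t) j j)) / (Q ^+ s) j i0) => T.
  rewrite ler_pdivlMr // mulr_suml.
  apply: (@le_trans _ _ (series (fun t => (Q ^+ t) j j) (s + T)%N)); last first.
    apply: nondecreasing_cvgn_le (Dtrans j jD) _.
    by apply: nondecreasing_series => t _ _; exact: Q0.
  rewrite seriesEord /= big_split_ord /= -[leLHS]add0r; apply: lerD.
    by apply: sumr_ge0.
  by apply: ler_sum => t _; rewrite mulrC stochastic_expD_ge.
have [M hM] := choice visits.
(* The rows of [Q ^+ t] sum to 1, so the visits before time [T] total [T], which no constant
   bounds. *)
have total T : T%:R <= \sum_j M j.
  have -> : T%:R = \sum_j \sum_(t < T) (Q ^+ t) i0 j.
    rewrite exchange_big /= (eq_bigr (fun=> 1)) ?sumr_const ?card_ord // => t _.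
    by case: (stochastic_exp _ t Qs).
  by apply: ler_sum => j _; exact: hM.
have := total (Num.truncn (\sum_j M j)).+1.
by rewrite leNgt truncnS_gt.
Qed.

End Stochastic.

(** * Sequences of reals *)

(** Meant for averages [u] whose convergence is not assumed; [b / T%:R] absorbs a bounded remainder
    divided by [T]. *)
Lemma limn_inf_dist_le {R : realType} (u : nat -> R) (c d b : R) :
  (forall T, (0 < T)%N -> `|u T - c| <= d + b / T%:R) -> `|c - limn_inf u| <= d.
Proof.
move=> ucd.
have b1 T : (0 < T)%N -> `|u T - c| <= d + `|b|.
  move=> T0; apply: le_trans (ucd T T0) _; rewrite lerD2l.
  apply: le_trans (ler_norm _) _; rewrite normrM ler_piMr // normfV normr_nat.
  by rewrite invf_le1 ?ltr0n // ler1n.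
have bd T : `|u T - c| <= d + `|b| + `|u 0%N - c|.
  case: T => [|T]; last by apply: le_trans (b1 T.+1 isT) _; rewrite lerDl.
  by rewrite lerDr; apply: le_trans (b1 1%N isT).
have ub : has_ubound (range u).
  exists (c + (d + `|b| + `|u 0%N - c|)) => _ [T _ <-].
  by have := bd T; rewrite ler_distl => /andP[].
have lb : has_lbound (range u).
  exists (c - (d + `|b| + `|u 0%N - c|)) => _ [T _ <-].
  by have := bd T; rewrite ler_distl => /andP[].
have cvi : cvgn (infs u) by apply: cvgP (cvg_infs_sup ub lb).
have small e : 0 < e -> \forall T \near \oo, (0 < T)%N /\ `|b| / T%:R <= e.
  move=> e0; exists (Num.truncn (`|b| / e)).+1 => // T /= leT.
  have T0 : (0 < T)%N by apply: leq_trans leT.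
  split => //; rewrite ler_pdivrMr ?ltr0n // mulrC -ler_pdivrMr //.
  by apply: le_trans (ltW (truncnS_gt _)) _; rewrite ler_nat.
have fromT e T m : 0 < e -> (0 < T)%N -> `|b| / T%:R <= e -> (T <= m)%N ->
    `|u m - c| <= d + e.
  move=> e0 T0 bT Tm; have m0 : (0 < m)%N by apply: leq_trans Tm.
  apply: le_trans (ucd m m0) _; rewrite lerD2l; apply: le_trans bT.
  apply: le_trans (ler_norm _) _; rewrite normrM ler_wpM2l // normfV normr_nat.
  by rewrite lef_pV2 ?posrE ?ltr0n // ler_nat.
apply/ler_addgt0Pr => e e0; rewrite distrC ler_distl /limn_inf; apply/andP; split.
- apply: limr_ge cvi _; have := small e e0; apply: filterS => T [T0 bT].
  apply: lb_le_inf; first by exists (u T); exists T => /=.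
  move=> _ [m /= Tm <-]; have := fromT e T m e0 T0 bT Tm.
  by rewrite ler_distl => /andP[].
- apply: limr_le cvi _; have := small e e0; apply: filterS => T [T0 bT].
  apply: (@le_trans _ _ (u T)).
    by apply: ge_inf; [exact: has_lbound_sdrop|exists T => /=].
  by have := fromT e T T e0 T0 bT (leqnn T); rewrite ler_distl => /andP[].
Qed.

(** Once [z] stays within [e / 2] of [l], the error of [a] exceeds [e / 2] by at most a term that is
    halved at each step. *)
Lemma cvg_halving {R : realType} (a z : nat -> R) (l : R) :
  (forall k, a k.+1 = (a k + z k) / 2) -> z @ \oo --> l -> a @ \oo --> l.
Proof.
move=> aS /cvgrPdist_le zl; apply/cvgrPdist_le => e e0.
have e2 : 0 < e / 2 by rewrite divr_gt0.
have [N _ zN] := zl _ e2.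
have decay m : `|l - a (m + N)%N| <= e / 2 + `|l - a N| / 2 ^+ m.
  elim: m => [|m IH]; first by rewrite expr0 divr1 lerDr ltW.
  rewrite addSn aS.
  have -> : l - (a (m + N)%N + z (m + N)%N) / 2 =
    (l - a (m + N)%N) / 2 + (l - z (m + N)%N) / 2 by field.
  have -> : `|l - a N| / 2 ^+ m.+1 = `|l - a N| / 2 ^+ m / 2.
    by rewrite exprS invfM mulrCA mulrC.
  apply: le_trans (ler_normD _ _) _; rewrite !normrM [`|2^-1|]ger0_norm ?invr_ge0 //.
  by have := zN (m + N)%N (leq_addl _ _); rewrite /=; lra.
have [M0 _ hM] : \forall m \near \oo, `|0 - `|l - a N| / 2 ^+ m| <= e / 2.
  have : (fun m => `|l - a N| / 2 ^+ m) @ \oo --> (0 : R).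
    under eq_fun do rewrite -exprVn.
    by apply: cvg_geometric; rewrite ger0_norm ?invr_ge0 // invf_lt1 // ltr1n.
  by move/cvgrPdist_le; apply.
exists (M0 + N)%N => // k /= leMk.
have -> : k = (k - N + N)%N by rewrite subnK //; lia.
apply: le_trans (decay _) _.
have := hM (k - N)%N; rewrite /= sub0r normrN ger0_norm ?divr_ge0 ?exprn_ge0 //.
have leM : (M0 <= k - N)%N by lia.
move=> /(_ leM); lra.
Qed.

(** * Bellman operators *)

Section BellmanOperators.
Context {R : realType} {n : nat} {A : finType}.
Variables (P : 'I_n -> A -> 'I_n -> R) (r : 'I_n -> A -> R) (a0 : A).
Hypothesis P_kernel : is_kernel P.
Implicit Types (V W : 'cV[R]_n) (p : 'I_n -> A -> R) (D : {set 'I_n}).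

Lemma Ppol_stochastic p : is_policy p -> stochastic (Ppol P p).
Proof.
move=> [p0 p1]; have [P0 P1] := P_kernel; split=> [i j|i].
  by rewrite mxE; apply: sumr_ge0 => a _; rewrite mulr_ge0.
under eq_bigr do rewrite mxE.
rewrite exchange_big /=; under eq_bigr do rewrite -mulr_sumr P1 mulr1.
exact: p1.
Qed.

Lemma sum_det_policy (d : 'I_n -> A) s (F : A -> R) :
  \sum_a det_policy R d s a * F a = F (d s).
Proof.
rewrite (bigD1 (d s)) //= /det_policy eqxx mul1r big1 ?addr0 // => a /negbTE ->.
by rewrite mul0r.
Qed.

Lemma det_policy_is_policy (d : 'I_n -> A) : is_policy (det_policy R d).
Proof.
split=> [s a|s]; first by rewrite /det_policy; case: eqP.
by under eq_bigr do rewrite -[det_policy _ _ _ _]mulr1; exact: sum_det_policy.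
Qed.

Lemma Ppol_det_policy (d : 'I_n -> A) s s' : Ppol P (det_policy R d) s s' = P s (d s) s'.
Proof. by rewrite mxE sum_det_policy. Qed.

Lemma Tbell_ge V s a : Qval P r V s a <= Tbell P r a0 V s 0.
Proof. by rewrite mxE; exact: le_bigmax. Qed.

Lemma Tbell_attained V s : exists a, Tbell P r a0 V s 0 = Qval P r V s a.
Proof.
rewrite mxE; elim/big_ind: _ => [|x y [a ->] [b ->]|a _]; first by exists a0.
  by case: (leP (Qval P r V s a) (Qval P r V s b)); [exists b|exists a].
by exists a.
Qed.

Lemma Qval_shift V c s a : Qval P r (V + c *: ones) s a = Qval P r V s a + c.
Proof.
have [_ P1] := P_kernel; rewrite /Qval -addrA; congr (_ + _).
under eq_bigr do rewrite !mxE mulr1 mulrDr.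
by rewrite big_split /= -mulr_suml P1 mul1r.
Qed.

Lemma Tbell_shift V c : Tbell P r a0 (V + c *: ones) = Tbell P r a0 V + c *: ones.
Proof.
apply/colP => s; rewrite [RHS]mxE [X in _ = _ + X]mxE [ones _ _]mxE mulr1.
apply/eqP; rewrite eq_le; apply/andP; split.
  have [a ->] := Tbell_attained (V + c *: ones) s.
  by rewrite Qval_shift lerD2r Tbell_ge.
have [a ->] := Tbell_attained V s.
by rewrite -Qval_shift Tbell_ge.
Qed.

(** An action optimal for one argument is available for the other, so the maxima differ by at most
    an average of coordinates of the difference. *)
Lemma Tbell_nonexpansive V W :
  `|Tbell P r a0 V - Tbell P r a0 W| <= `|V - W|.
Proof.
have [P0 P1] := P_kernel.
have le V' W' s : Tbell P r a0 V' s 0 - Tbell P r a0 W' s 0 <= `|V' - W'|.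
  have [a ->] := Tbell_attained V' s.
  apply: (@le_trans _ _ (Qval P r V' s a - Qval P r W' s a)).
    by rewrite lerD2l lerN2 Tbell_ge.
  rewrite /Qval opprD addrACA subrr add0r -sumrB.
  under eq_bigr do rewrite -mulrBr.
  apply: le_trans (ler_norm _) _.
  have -> : \sum_s' P s a s' * (V' s' 0 - W' s' 0) = \sum_s' P s a s' * (V' - W') s' 0.
    by apply: eq_bigr => s' _; rewrite !mxE.
  exact: average_norm_le.
apply: mx_norm_le_coord => // s; rewrite mxE [X in _ + X]mxE ler_norml le andbT.
by rewrite lerNl opprB distrC le.
Qed.

Lemma greedy_policy V : exists p, is_policy p /\ Tpol P r p V = Tbell P r a0 V.
Proof.
have [d hd] := choice (Tbell_attained V).
exists (det_policy R d); split; first exact: det_policy_is_policy.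
apply/colP => s; rewrite hd mxE [X in X + _]mxE [X in _ + X]mxE sum_det_policy.
by congr (_ + _); apply: eq_bigr => s' _; rewrite Ppol_det_policy.
Qed.

(** The reward is [delta + c *: ones + V - Q *m V]; in the sums over time the last two terms
    telescope, and the average of the rest is within the norm of [delta] of [c]. *)
Lemma gain_dist_le p V c : is_policy p ->
  `|c *: ones - gain P r p| <= `|Tpol P r p V - V - c *: ones|.
Proof.
move=> p_policy; set delta := _ - _ - _.
have Qs := Ppol_stochastic _ p_policy; set Q := Ppol P p.
apply: mx_norm_le_coord => // s; rewrite !mxE mulr1.
(* The constant bounds the telescoped remainder [V - Q ^+ T *m V] uniformly in [T]. *)
apply: (@limn_inf_dist_le _ _ _ _ (`|V| + `|V|)) => T T0.
have rE : rpol r p = delta + c *: ones + V - Q *m V.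
  by rewrite /delta subrK subrK /Tpol addrK.
clearbody delta.
have sumE : \sum_(t < T) (Q ^+ t *m rpol r p) =
    \sum_(t < T) (Q ^+ t *m delta) + T%:R *: (c *: ones) + (V - Q ^+ T *m V).
  elim: T {T0} => [|T IH]; first by rewrite !big_ord0 scale0r expr0 mul1mx subrr !addr0.
  rewrite !big_ord_recr /= IH rE.
  rewrite -addrA !mulmxDr (stochastic_ones _ _ (stochastic_exp _ T Qs)).
  rewrite mulmxN mulmxA -[_ *m Q]exprSr -natr1 scalerDl scale1r.
  move: (c *: ones) (\sum_(t < T) _) (_ *m delta) (_ *m V) (_ *m V) (T%:R *: _).
  by move=> C X Y Z W U; apply/colP => i; rewrite !mxE; ring.
have T0' : T%:R != 0 :> R by rewrite pnatr_eq0 -lt0n.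
have -> : \sum_(t < T) (Q ^+ t *m rpol r p) s 0 =
    \sum_(t < T) (Q ^+ t *m delta) s 0 + T%:R * c + (V - Q ^+ T *m V) s 0.
  rewrite -summxE sumE mxE [X in X + _ = _]mxE summxE; congr (_ + _ + _).
  by rewrite !mxE mulr1.
rewrite !mulrDr mulKf // addrAC addrK.
apply: le_trans (ler_normD _ _) _; apply: lerD.
  rewrite normrM normfV normr_nat ler_pdivrMl ?ltr0n //.
  apply: le_trans (ler_norm_sum _ _ _) _.
  apply: (@le_trans _ _ (\sum_(t < T) `|delta|)); last by rewrite sumr_const card_ord mulr_natl.
  apply: ler_sum => t _; apply: le_trans (mx_norm_ge_coord _ _) _.
  exact/stochastic_norm_le/stochastic_exp.
rewrite normrM normfV normr_nat mulrC ler_pM2r ?invr_gt0 ?ltr0n //.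
apply: le_trans (mx_norm_ge_coord _ _) _; apply: le_trans (ler_normB _ _) _.
by rewrite lerD2l; exact/stochastic_norm_le/stochastic_exp.
Qed.

Lemma closed_meets_recurrent_class p D (C : {set 'I_n}) : is_policy p ->
  (forall s, s \notin C -> transient P p s) ->
  (forall s s', s \in D -> 0 < Ppol P p s s' -> s' \in D) -> (exists s, s \in D) ->
  exists2 s, s \in D & s \in C.
Proof.
move=> p_policy Ctrans Dcl Dne; apply: contrapT => noDC.
apply: (closed_set_not_transient _ D (Ppol_stochastic _ p_policy) Dcl Dne).
move=> s sD; apply: Ctrans; apply/negP => sC; apply: noDC; by exists s.
Qed.

(** The sets of minimal and maximal gain both meet the communicating class; some policy leads from
    the first to the second without leaving the first, so they share a state. *)
Lemma mod_bellman_gain_const (g h : 'cV[R]_n) : weakly_communicating P ->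
  mod_bellman P r a0 g h -> exists c, g = c *: ones.
Proof.
move=> [C [Ccl [Ccomm Ctrans]]] [gmax [_ [p [p_policy [gp _]]]]].
have [P0 P1] := P_kernel.
case: (pickP (xpredT : pred 'I_n)) => [i0 _|noI]; last first.
  by exists 0; apply/colP => i; have := noI i.
have gP s a : \sum_s' P s a s' * g s' 0 <= g s 0.
  by rewrite -[in leRHS]gmax mxE; exact: (le_bigmax _ (fun a => \sum_s' P s a s' * g s' 0)).
have [smin _ gmin'] := @arg_minP _ _ _ i0 xpredT (fun s => g s 0) isT.
have ge_min s : g smin 0 <= g s 0 by exact: gmin'.
have [smax _ gmax'] := @arg_maxP _ _ _ i0 xpredT (fun s => g s 0) isT.
have le_max s : g s 0 <= g smax 0 by exact: gmax'.
pose Dmin := [set s | g s 0 == g smin 0]%SET.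
pose Dmax := [set s | g s 0 == g smax 0]%SET.
(* No action has average gain above [g s], and at a minimum none can have less, so all successors
   are minimal too. *)
have DminP s a s' : s \in Dmin -> 0 < P s a s' -> s' \in Dmin.
  rewrite !inE => /eqP gs Ps; apply/eqP.
  apply: (average_min_eq _ (fun s => g s 0) _ (P0 s a) (P1 s a) _ _ _ Ps) => [j|]; first exact: ge_min.
  by rewrite -gs gP.
(* Averaging under [p] preserves [g], so the same argument applies to [- g]. *)
have DmaxP s s' : s \in Dmax -> 0 < Ppol P p s s' -> s' \in Dmax.
  rewrite !inE => /eqP gs Ps; apply/eqP/oppr_inj.
  have [Q0 Q1] := Ppol_stochastic _ p_policy.
  apply: (average_min_eq _ (fun s => - g s 0) _ (Q0 s) (Q1 s) _ _ _ Ps) => [j|].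
    by rewrite lerN2 le_max.
  under eq_bigr do rewrite mulrN.
  by rewrite sumrN lerN2 -gs -[in leLHS]gp mxE.
have [s1 s1min s1C] : exists2 s, s \in Dmin & s \in C.
  apply: (closed_meets_recurrent_class _ _ _ (det_policy_is_policy (fun=> a0))).
  - by move=> s sC; apply: Ctrans (det_policy_is_policy _).
  - by move=> s s' sD; rewrite Ppol_det_policy; exact: DminP.
  - by exists smin; rewrite inE.
have [s2 s2max s2C] : exists2 s, s \in Dmax & s \in C.
  apply: (closed_meets_recurrent_class _ _ _ p_policy _ DmaxP).
  - by move=> s sC; exact: Ctrans.
  - by exists smax; rewrite inE.
have [d [t dt]] := Ccomm s1 s2 s1C s2C.
have s2min : s2 \in Dmin.
  apply: closed_exp s1min dt; first exact/Ppol_stochastic/det_policy_is_policy.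
  by move=> s s' sD; rewrite Ppol_det_policy; exact: DminP.
have gminmax : g smin 0 = g smax 0.
  by move: s2min s2max; rewrite !inE => /eqP <- /eqP.
exists (g smin 0); apply/colP => s; rewrite !mxE mulr1; apply/eqP.
by rewrite eq_le ge_min andbT gminmax le_max.
Qed.

End BellmanOperators.

(** * Rate and convergence of relaxed relative value iteration *)

Theorem theorem5 (R : realType) (n : nat) (A : finType) (a0 : A)
  (P : 'I_n -> A -> 'I_n -> R) (r : 'I_n -> A -> R)
  (gs hs : 'cV[R]_n) (f : 'cV[R]_n -> R) (h : nat -> 'cV[R]_n)
  (pik : nat -> 'I_n -> A -> R) :
  is_kernel P ->
  weakly_communicating P ->
  mod_bellman P r a0 gs hs ->
  continuous f ->
  (forall x c, f (x + c *: ones) = f x + c) ->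
  (forall k, h k.+1 = 2^-1 *: h k + 2^-1 *: (Tbell P r a0 (h k) - f (h k) *: ones)) ->
  (forall k, (1 <= k)%N -> is_policy (pik k) /\
       Tpol P r (pik k) (h k) = Tbell P r a0 (h k)) ->
  (forall k, (1 <= k)%N ->
     supn (gs - gain P r (pik k)) <= supn (Tbell P r a0 (h k) - h k - gs) /\
     supn (Tbell P r a0 (h k) - h k - gs)
       <= 4 / Num.sqrt (pi * k%:R) * supn (h 0%N - hs)) /\
  (exists hinf : 'cV[R]_n, mod_bellman P r a0 gs hinf /\
     h @ \oo --> hinf /\ (fun k => f (h k) *: ones) @ \oo --> gs).
Proof.
move=> P_kernel wcomm gh_bellman f_cont f_shift hS greedy.
have [c gsE] := mod_bellman_gain_const _ _ _ P_kernel _ _ wcomm gh_bellman.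
have [gs_max [hs_bellman _]] := gh_bellman.
pose T V := Tbell P r a0 V - c *: ones.
have T_nonexp V W : `|T V - T W| <= `|V - W|.
  by rewrite /T opprB addrA subrK; exact: Tbell_nonexpansive.
have Ths : T hs = hs by rewrite /T hs_bellman gsE addrK.
pose y := fun k => iter k (fun V => 2^-1 *: (V + T V)) (h 0%N).
have yS k : y k.+1 = 2^-1 *: (y k + T (y k)) by [].
(* On substituting [y k + shift k *: ones] for [h k], the shift leaving the Bellman operator cancels
   the one leaving [f]; this averaging remains. *)
pose shift := fix shift k := if k is k'.+1 then (shift k' + (c - f (y k'))) / 2 else 0.
have hE k : h k = y k + shift k *: ones.
  elim: k => [|k IH]; first by rewrite scale0r addr0.
  rewrite hS yS IH f_shift Tbell_shift // /T /=.
  by apply/colP => s; rewrite !mxE; field.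
have residualE k : Tbell P r a0 (h k) - h k - gs = T (y k) - y k.
  rewrite hE Tbell_shift // gsE /T.
  by apply/colP => s; rewrite !mxE; ring.
have residual_le k : `|T (y k) - y k| <= 4 / Num.sqrt (pi * k.+1%:R) * `|h 0%N - hs|.
  exact: (km_residual T y T_nonexp yS).
split.
  move=> k k_gt0; rewrite !supnE; split.
    have [pik_policy pik_greedy] := greedy k k_gt0.
    by rewrite -pik_greedy gsE; exact: gain_dist_le.
  rewrite residualE; apply: le_trans (residual_le k) _.
  (* The Wallis estimate holds with [k.+1] and is weakened to [k], positive here. *)
  have pk_gt0 : 0 < pi * k%:R :> R by rewrite mulr_gt0 ?pi_gt0 ?ltr0n.
  rewrite ler_wpM2r // ler_wpM2l // lef_pV2 ?posrE ?sqrtr_gt0 //; last first.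
    by rewrite mulr_gt0 ?pi_gt0 ?ltr0n.
  by rewrite ler_wsqrtr // ler_wpM2l ?pi_ge0 // ler_nat.
have residual_cvg0 : (fun k => `|T (y k) - y k|) @ \oo --> (0 : R).
  have bound_cvg : (fun k => 4 / Num.sqrt (pi * k.+1%:R) * `|h 0%N - hs|) @ \oo --> (0 : R).
    have -> : (fun k => 4 / Num.sqrt (pi * k.+1%:R) * `|h 0%N - hs|) =
        (fun k => 4 * Num.sqrt (pi^-1 * harmonic k) * `|h 0%N - hs|).
      by apply/funext => k; rewrite /harmonic -invfM sqrtrV // mulr_ge0 ?pi_ge0.
    have root_cvg : (fun k => Num.sqrt (pi^-1 * harmonic k)) @ \oo --> Num.sqrt (pi^-1 * 0 : R).
      apply: continuous_cvg; first exact: sqrt_continuous.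
      by apply: cvgMl_tmp; exact: cvg_harmonic.
    have := cvgMr_tmp (b := `|h 0%N - hs|) (cvgMl_tmp (a := 4) root_cvg).
    by rewrite mulr0 sqrtr0 mulr0 mul0r; apply.
  apply: squeeze_cvgr (cvg_cst 0) bound_cvg.
  by apply: nearW => k; rewrite normr_ge0 residual_le.
(* Fejer monotonicity around [hs] keeps [y] in a ball around 0, which is compact. *)
have y_bounded k : `|y k| <= `|h 0%N - hs| + `|hs|.
  have -> : y k = (y k - hs) + hs by rewrite subrK.
  apply: le_trans (ler_normD _ _) _; rewrite lerD2r.
  by elim: k => // k IH; apply: le_trans (km_fejer T y T_nonexp yS _ k Ths) IH.
have [yinf Tyinf y_cvg] := km_cvg_compact T y _ T_nonexp yS
  (cV_ball_compact n (`|h 0%N - hs| + `|hs|)) y_bounded residual_cvg0.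
have fy_cvg : (fun k => f (y k)) @ \oo --> f yinf.
  by apply: continuous_cvg => //; exact: f_cont.
have shift_cvg : shift @ \oo --> c - f yinf.
  apply: (@cvg_halving _ shift (fun k => c - f (y k))) => //.
  by apply: cvgB => //; exact: cvg_cst.
(* The limit of [y] plus that of the shift; by [Tbell_shift] it inherits the Bellman equation from
   [T yinf = yinf]. *)
exists (yinf + (c - f yinf) *: ones); split; last split.
- split=> //; split.
    rewrite Tbell_shift // gsE addrAC; congr (_ + _).
    by rewrite -[X in X + _]Tyinf subrK.
  (* As [gs] is constant, every policy preserves it, so a greedy one attains both maxima. *)
  have [p [p_policy p_greedy]] := greedy_policy P r a0
    (yinf + (c - f yinf) *: ones).
  exists p; split=> //; split.
    by rewrite gsE; exact/stochastic_ones/Ppol_stochastic.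
  rewrite p_greedy Tbell_shift // gsE addrAC; congr (_ + _).
  by rewrite -[X in X + _]Tyinf subrK.
- have -> : h = (fun k => y k + shift k *: ones) by apply/funext.
  by apply: cvgD => //; exact: cvgZr_tmp.
- have -> : (fun k => f (h k) *: ones) = (fun k => (f (y k) + shift k) *: ones : 'cV[R]_n).
    by apply/funext => k; rewrite hE f_shift.
  rewrite gsE; apply: cvgZr_tmp.
  have -> : c = f yinf + (c - f yinf) by rewrite addrC subrK.
  exact: cvgD.
Qed.
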